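(* Let $0\leq n<N$ be integers. Then $$d_2(z^N,\mathcal{R}_{n,n})\ \geq\ \sqrt{1-\frac{n}{N}}.$$
   Context: $\mathbb{T}$ is the unit circle in $\mathbb{C}$. $L^2=L^2(\mathbb{T})$ carries the normalized norm $\|f\|_2=\left(\frac{1}{2\pi}\int_0^{2\pi}|f(e^{i\theta})|^2\,d\theta\right)^{1/2}$. $\mathcal{P}_n$ is the space of complex polynomials of degree at most $n$. $\mathcal{R}_{n,n}$ is the set of rational functions that can be written $p/q$ with $p\in\mathcal{P}_n$ and $q\in\mathcal{P}_n$ having no roots on $\mathbb{T}$ (regarded as elements of $L^2$). For $f\in L^2$, $d_2(f,\mathcal{R}_{n,n})=\inf_{r\in\mathcal{R}_{n,n}}\|f-r\|_2$ is the $L^2$-distance from $f$ to $\mathcal{R}_{n,n}$. Here $z^N$ denotes the function $z\mapsto z^N$ on $\mathbb{T}$. *)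

(* Defs.v *)
From HB Require Import structures.
From mathcomp Require Import all_boot all_order all_algebra.
From mathcomp Require Import all_classical all_reals all_analysis.
From mathcomp Require Import complex.

Set Implicit Arguments.
Unset Strict Implicit.
Unset Printing Implicit Defensive.

Import Order.TTheory GRing.Theory Num.Theory.
Import numFieldNormedType.Exports.
Import ComplexField.Normc.

Local Open Scope classical_set_scope.
Local Open Scope complex_scope.
Local Open Scope ring_scope.

Definition circle (R : realType) := {z : R[i] | normc z == 1}.

Lemma normc_cis (R : realType) (t : R) : normc (cos t +i* sin t) == 1.
Proof. by rewrite /= cos2Dsin2 sqrtr1. Qed.

(* The point e^{it} of the circle. *)
Definition expi (R : realType) (t : R) : circle R :=
  exist _ (cos t +i* sin t) (normc_cis t).

(* Extended-real valued, so that no square-integrability side condition is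
   needed; on L^2 the value is finite. Functions that agree almost everywhere
   are not identified: the norm does not distinguish them. *)
Definition norm2 (R : realType) (f : circle R -> R[i]) : \bar R :=
  (sqrte (((2 * pi)^-1)%R%:E *
    \int[lebesgue_measure]_(t in `[0%R, (2 * pi)%R])
      (normc (f (expi t)) ^+ 2)%R%:E))%E.

Definition polys (R : realType) (n : nat) : set {poly R[i]} :=
  [set p | (size p <= n.+1)%N].

Definition ratfuns (R : realType) (n : nat) : set (circle R -> R[i]) :=
  [set r | exists p q : {poly R[i]},
    [/\ polys n p, polys n q, forall z : circle R, ~~ root q (val z) &
        r = fun z : circle R => p.[val z] / q.[val z]] ].

Definition dist2 (R : realType) (f : circle R -> R[i])
    (A : set (circle R -> R[i])) : \bar R :=
  ereal_inf [set norm2 (fun z => f z - r z) | r in A].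

(* Main.v *)
Require Import Defs.
From HB Require Import structures.
From mathcomp Require Import all_boot all_order all_algebra.
From mathcomp Require Import all_classical all_reals all_analysis.
From mathcomp Require Import complex.
From mathcomp Require Import ring lra zify.

Import Order.TTheory GRing.Theory Num.Theory.
Import numFieldNormedType.Exports.
Local Open Scope classical_set_scope.
Local Open Scope ring_scope.

(** Write e = z^N - p/q on the circle, and let c_m be its m-th Fourier
    coefficient. The N x N Toeplitz matrix T with entries T i j = c_(N+j-i)
    carries both estimates.

    Upper bound. Each row of T lists Fourier coefficients of e at N distinct
    frequencies, so by Bessel's inequality its squared norm is at most the
    squared L^2 norm of e. Hence the squared Frobenius norm of T is at most
    N |e|_2^2 ([toeplitz_frobenius_le]).

    Lower bound. If u is the coefficient row of a polynomial of degree < N,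
    then (u T)_j is the Fourier coefficient of e u at N + j. For u = v q with
    v of degree < N - n, one has e u = z^N u - p v, a polynomial; since p v has
    degree < N, that coefficient is u_j. Thus T fixes every vector of a space of
    dimension N - n, namely the multiples of q ([toeplitz_ratfun_fix]). This is
    Kronecker's theorem in disguise: the Toeplitz matrix of z^N is the identity,
    and the one of p/q has rank at most n, wherever the poles of p/q lie.
    A matrix fixing a space of dimension r has squared Frobenius norm at
    least r ([row_free_fix_le_frobenius]).

    Together, N - n <= N |e|_2^2. *)

Set Implicit Arguments.
Unset Strict Implicit.

(** * Matrices with many fixed row vectors *)

Section FixedRows.
Local Open Scope sesquilinear_scope.

Lemma mxtrace_mul_adj (C : numClosedFieldType) (m n : nat) (A : 'M[C]_(m, n)) :
  \tr (A *m A^t*) = \sum_i \sum_j `|A i j| ^+ 2.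
Proof.
rewrite /mxtrace; apply: eq_bigr => i _; rewrite mxE.
by apply: eq_bigr => j _; rewrite !mxE normCK.
Qed.

Lemma mxtrace_adj (C : numClosedFieldType) (n : nat) (A : 'M[C]_n) :
  \tr (A^t*) = (\tr A)^*.
Proof. by rewrite /mxtrace rmorph_sum; apply: eq_bigr => i _; rewrite !mxE. Qed.

(** With P the orthogonal projector onto the row space of [Q], the hypothesis
    says P E = P. Then tr (E P) = tr P = r, so that |E - P|^2 = |E|^2 - r
    for the Frobenius norm. *)
Lemma row_free_fix_le_frobenius (C : numClosedFieldType) (r N : nat)
    (Q : 'M[C]_(r, N)) (E : 'M[C]_N) :
  row_free Q -> Q *m E = Q -> r%:R <= \sum_i \sum_j `|E i j| ^+ 2.
Proof.
move=> freeQ QE; have rN : (r <= N)%N by rewrite -(eqP freeQ) rank_leq_col.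
(* The rows of U are an orthonormal basis of the row space of Q. *)
set U := schmidt Q.
have UU : U *m U^t* = 1%:M by apply/unitarymxP/schmidt_unitarymx.
have UE : U *m E = U.
  have /submxP[D ->] : (U <= Q)%MS by rewrite eqmx_schmidt_free.
  by rewrite -mulmxA QE.
set P := U^t* *m U.
have PE : P *m E = P by rewrite -mulmxA UE.
have Padj : P^t* = P.
  apply/matrixP=> i j; rewrite !mxE rmorph_sum; apply: eq_bigr => k _.
  by rewrite !mxE rmorphM /= conjCK mulrC.
have trP : \tr P = r%:R by rewrite mxtrace_mulC UU mxtrace1.
have PP : P *m P = P by rewrite /P mulmxA -(mulmxA _ U) UU mulmx1.
have trEP : \tr (E *m P^t*) = r%:R by rewrite Padj mxtrace_mulC PE.
have trPE : \tr (P *m E^t*) = r%:R.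
  have -> : P *m E^t* = (E *m P^t*)^t*.
    by rewrite Padj trmx_mul map_mxM/= Padj.
  by rewrite mxtrace_adj trEP conjC_nat.
rewrite -mxtrace_mul_adj -subr_ge0.
have -> : \tr (E *m E^t*) - r%:R = \tr ((E - P) *m (E - P)^t*).
  have -> : (E - P)^t* = E^t* - P^t* by rewrite linearB /= map_mxB.
  rewrite mulmxBl !mulmxBr !linearB/= trEP trPE Padj PP trP; ring.
rewrite mxtrace_mul_adj.
by do 2![apply: sumr_ge0 => ? _]; rewrite exprn_ge0.
Qed.

End FixedRows.

(** * Means over a period *)

Section Means.
Local Open Scope complex_scope.
Local Notation Re := (@complex.Re _).
Local Notation Im := (@complex.Im _).
Local Notation normc := ComplexField.Normc.normc.

Definition rmean (R : realType) (g : R -> R) : R :=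
  (2 * pi)^-1 * \int[lebesgue_measure]_(t in `[0, 2 * pi]) g t.

Lemma continuous_integrable_period (R : realType) (g : R -> R) :
  continuous g ->
  (@lebesgue_measure R).-integrable `[0, 2 * pi] (EFin \o g).
Proof.
move=> cg; apply: continuous_compact_integrable; first exact: segment_compact.
exact: continuous_subspaceT.
Qed.

Lemma rmeanD (R : realType) (g h : R -> R) : continuous g -> continuous h ->
  rmean (fun t => g t + h t) = rmean g + rmean h.
Proof.
move=> cg ch; rewrite -[RHS]mulrDr /rmean RintegralD//;
  exact: continuous_integrable_period.
Qed.

Lemma rmeanZ (R : realType) (a : R) (g : R -> R) : continuous g ->
  rmean (fun t => a * g t) = a * rmean g.
Proof.
by move=> cg; rewrite [RHS]mulrCA /rmean RintegralZl//;
  exact: continuous_integrable_period.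
Qed.

Lemma rmean_ge0 (R : realType) (g : R -> R) :
  (forall t, 0 <= g t) -> 0 <= rmean g.
Proof.
move=> g0; apply: mulr_ge0; last exact: Rintegral_ge0.
by rewrite invr_ge0 mulr_ge0 ?pi_ge0.
Qed.

Lemma rmean1 (R : realType) : rmean (fun _ : R => 1) = 1 :> R.
Proof.
have p0 : 0 < 2 * pi :> R by rewrite mulr_gt0 ?pi_gt0.
rewrite /rmean Rintegral_cst//= lebesgue_measure_itv/= lte_fin p0/=.
by rewrite oppr0 addr0 mul1r mulVf// gt_eqF.
Qed.

Lemma rmean0 (R : realType) : rmean (fun _ : R => 0) = 0 :> R.
Proof. by rewrite /rmean Rintegral_cst//= mul0r mulr0. Qed.

(** This is the fundamental theorem of calculus; it gives the orthogonality of
    the exponentials. *)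
Lemma rmean_derivative (R : realType) (G g : R -> R) :
  (forall t, is_derive (t : R) (1 : R) G (g t)) -> continuous g ->
  G (2 * pi) = G 0 -> rmean g = 0.
Proof.
move=> dG cg G2pi; rewrite /rmean /Rintegral.
have p0 : 0 < 2 * pi :> R by rewrite mulr_gt0 ?pi_gt0.
have cG : continuous G.
  move=> t; apply/differentiable_continuous/derivable1_diffP.
  by have [] := dG t.
rewrite (continuous_FTC2 p0 (F := G)).
- by rewrite G2pi subee//= mulr0.
- exact: continuous_subspaceT.
- split; first by move=> t _; have [] := dG t.
  + exact/cvg_at_right_filter/cG.
  + exact/cvg_at_left_filter/cG.
- by move=> t _; rewrite derive1E; have [] := dG t.
Qed.

Lemma rmean_cos (R : realType) (d : nat) : (0 < d)%N ->
  rmean (fun t : R => cos (d%:R * t)) = 0 :> R.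
Proof.
move=> d0; have dn0 : d%:R != 0 :> R by rewrite pnatr_eq0 -lt0n.
apply: (@rmean_derivative _ (d%:R^-1 \*: (sin \o (d%:R \*: id)))).
- move=> t; apply: is_derive_eq => /=.
  by rewrite /GRing.scale/= mulr1 mulrCA mulVf ?mulr1.
- move=> t; apply: continuous_comp; last exact: continuous_cos.
  exact: mulrl_continuous.
- rewrite /= /GRing.scale/= mulr0; congr (_ * _).
  by rewrite -[RHS](periodicn (@sinD2pi R) d) add0r !mulr_natl.
Qed.

Lemma rmean_sin (R : realType) (d : nat) : (0 < d)%N ->
  rmean (fun t : R => sin (d%:R * t)) = 0 :> R.
Proof.
move=> d0; have dn0 : d%:R != 0 :> R by rewrite pnatr_eq0 -lt0n.
apply: (@rmean_derivative _ (- d%:R^-1 \*: (cos \o (d%:R \*: id)))).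
- move=> t; apply: is_derive_eq => /=.
  by rewrite /GRing.scale/=; field.
- move=> t; apply: continuous_comp; last exact: continuous_sin.
  exact: mulrl_continuous.
- rewrite /= /GRing.scale/= mulr0; congr (_ * _).
  by rewrite -[RHS](periodicn (@cosD2pi R) d) add0r !mulr_natl.
Qed.

(** Continuity is taken componentwise because means are: the real and imaginary
    parts are what gets integrated. *)
Definition ccontinuous (R : realType) (f : R -> R[i]) :=
  continuous (fun t => Re (f t)) /\ continuous (fun t => Im (f t)).

Definition cmean (R : realType) (f : R -> R[i]) : R[i] :=
  rmean (fun t => Re (f t)) +i* rmean (fun t => Im (f t)).

Lemma ccontinuous_cst (R : realType) (a : R[i]) : ccontinuous (fun _ : R => a).
Proof. by split; apply: cst_continuous. Qed.

Lemma ccontinuousD (R : realType) (f g : R -> R[i]) :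
  ccontinuous f -> ccontinuous g -> ccontinuous (fun t => f t + g t).
Proof.
move=> [cf1 cf2] [cg1 cg2]; split => t.
  rewrite [X in continuous_at _ X](_ : _ = (fun t => Re (f t) + Re (g t))).
    exact: continuousD (cf1 t) (cg1 t).
  by apply/funext => u; case: (f u) (g u) => [a b] [c d].
rewrite [X in continuous_at _ X](_ : _ = (fun t => Im (f t) + Im (g t))).
  exact: continuousD (cf2 t) (cg2 t).
by apply/funext => u; case: (f u) (g u) => [a b] [c d].
Qed.

Lemma ccontinuousM (R : realType) (f g : R -> R[i]) :
  ccontinuous f -> ccontinuous g -> ccontinuous (fun t => f t * g t).
Proof.
move=> [cf1 cf2] [cg1 cg2]; split => t.
  rewrite [X in continuous_at _ X](_ : _ =
      (fun t => Re (f t) * Re (g t) - Im (f t) * Im (g t))).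
    by apply: cvgB; apply: cvgM;
      solve [exact: cf1|exact: cf2|exact: cg1|exact: cg2].
  by apply/funext => u; case: (f u) (g u) => [a b] [c d].
rewrite [X in continuous_at _ X](_ : _ =
    (fun t => Re (f t) * Im (g t) + Im (f t) * Re (g t))).
  by apply: cvgD; apply: cvgM;
    solve [exact: cf1|exact: cf2|exact: cg1|exact: cg2].
by apply/funext => u; case: (f u) (g u) => [a b] [c d].
Qed.

Lemma ccontinuousZ (R : realType) (a : R[i]) (f : R -> R[i]) :
  ccontinuous f -> ccontinuous (fun t => a * f t).
Proof. exact: ccontinuousM (ccontinuous_cst a). Qed.

Lemma ccontinuousJ (R : realType) (f : R -> R[i]) :
  ccontinuous f -> ccontinuous (fun t => (f t)^*).
Proof.
move=> [cf1 cf2]; split => t.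
  rewrite [X in continuous_at _ X](_ : _ = (fun t => Re (f t))).
    exact: cf1.
  by apply/funext => u; case: (f u).
rewrite [X in continuous_at _ X](_ : _ = (fun t => - Im (f t))).
  exact: continuousN (cf2 t).
by apply/funext => u; case: (f u).
Qed.

Lemma ccontinuousV (R : realType) (f : R -> R[i]) :
  ccontinuous f -> (forall t, f t != 0) -> ccontinuous (fun t => (f t)^-1).
Proof.
move=> [cf1 cf2] f0.
have cn : continuous (fun t => (Re (f t) ^+ 2 + Im (f t) ^+ 2)^-1).
  move=> t; apply: cvgV; last first.
    by apply: cvgD; apply: cvgM; solve [exact: cf1|exact: cf2].
  apply: contra (f0 t); case: (f t) => a b /=.
  by rewrite paddr_eq0 ?sqr_ge0// !sqrf_eq0 eq_complex.
split => t.
  rewrite [X in continuous_at _ X](_ : _ =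
      (fun t => Re (f t) * (Re (f t) ^+ 2 + Im (f t) ^+ 2)^-1)).
    exact: continuousM (cf1 t) (cn t).
  by apply/funext => u; case: (f u).
rewrite [X in continuous_at _ X](_ : _ =
    (fun t => - (Im (f t) * (Re (f t) ^+ 2 + Im (f t) ^+ 2)^-1))).
  exact: continuousN (continuousM (cf2 t) (cn t)).
by apply/funext => u; case: (f u).
Qed.

Lemma ccontinuous_expi (R : realType) : ccontinuous (fun t : R => val (expi t)).
Proof. by split; [exact: continuous_cos|exact: continuous_sin]. Qed.

Lemma ccontinuous_horner (R : realType) (p : {poly R[i]}) :
  ccontinuous (fun t : R => p.[val (expi t)]).
Proof.
elim/poly_ind: p => [|p c cp].
  under [X in ccontinuous X]eq_fun do rewrite horner0.
  exact: ccontinuous_cst.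
under [X in ccontinuous X]eq_fun do rewrite hornerMXaddC.
apply: ccontinuousD; last exact: ccontinuous_cst.
exact: ccontinuousM (ccontinuous_expi R).
Qed.

Lemma ccontinuousX (R : realType) (f : R -> R[i]) (d : nat) :
  ccontinuous f -> ccontinuous (fun t => f t ^+ d).
Proof.
move=> cf; elim: d => [|d IHd]; first exact: ccontinuous_cst.
by under [X in ccontinuous X]eq_fun do rewrite exprS; exact: ccontinuousM.
Qed.

Lemma ccontinuous_sum (R : realType) (n : nat) (f : 'I_n -> R -> R[i]) :
  (forall i, ccontinuous (f i)) -> ccontinuous (fun t => \sum_(i < n) f i t).
Proof.
elim: n f => [|n IHn] f cf.
  under [X in ccontinuous X]eq_fun do rewrite big_ord0.
  exact: ccontinuous_cst.
under [X in ccontinuous X]eq_fun do rewrite big_ord_recr.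
by apply: ccontinuousD => //; exact: IHn.
Qed.

Lemma cmeanD (R : realType) (f g : R -> R[i]) :
  ccontinuous f -> ccontinuous g ->
  cmean (fun t => f t + g t) = cmean f + cmean g.
Proof.
move=> [cf1 cf2] [cg1 cg2]; rewrite /cmean; simpc.
by congr (_ +i* _); rewrite -rmeanD//; congr rmean; apply/funext => t;
  case: (f t) (g t) => [a b] [c d].
Qed.

Lemma cmeanZ (R : realType) (a : R[i]) (f : R -> R[i]) : ccontinuous f ->
  cmean (fun t => a * f t) = a * cmean f.
Proof.
case: a => a b [cf1 cf2]; rewrite /cmean; simpc.
have cZ (c : R) (g : R -> R) : continuous g -> continuous (fun t => c * g t).
  by move=> cg t; apply: continuousM; [exact: cst_continuous|exact: cg].
congr (_ +i* _).
  rewrite -mulNr -!rmeanZ// -rmeanD; try exact: cZ.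
  by congr rmean; apply/funext => t; case: (f t) => c d /=; rewrite mulNr.
rewrite -!rmeanZ// -rmeanD; try exact: cZ.
by congr rmean; apply/funext => t; case: (f t).
Qed.

Lemma cmean_sum (R : realType) (n : nat) (f : 'I_n -> R -> R[i]) :
  (forall i, ccontinuous (f i)) ->
  cmean (fun t => \sum_(i < n) f i t) = \sum_(i < n) cmean (f i).
Proof.
elim: n f => [|n IHn] f cf.
  rewrite big_ord0; under eq_fun do rewrite big_ord0 -(mul0r 0).
  by rewrite cmeanZ ?mul0r//; exact: ccontinuous_cst.
rewrite big_ord_recr /=; under eq_fun do rewrite big_ord_recr.
by rewrite cmeanD ?IHn//; exact: ccontinuous_sum.
Qed.

Lemma cmeanJ (R : realType) (f : R -> R[i]) : ccontinuous f ->
  cmean (fun t => (f t)^*) = (cmean f)^*.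
Proof.
move=> [cf1 cf2]; rewrite /cmean /=; congr (_ +i* _).
  by congr rmean; apply/funext => t; case: (f t).
rewrite -mulN1r -rmeanZ//; congr rmean; apply/funext => t.
by case: (f t) => a b /=; rewrite mulN1r.
Qed.

Lemma cmean_ge0 (R : realType) (f : R -> R[i]) :
  (forall t, 0 <= f t) -> 0 <= cmean f.
Proof.
move=> f0; rewrite lecE /=; apply/andP; split.
  rewrite -[X in _ == X](rmean0 R); apply/eqP; congr rmean; apply/funext => t.
  by move: (f0 t); rewrite lecE => /andP[/eqP].
by apply: rmean_ge0 => t; move: (f0 t); rewrite lecE => /andP[].
Qed.

Lemma norm2_circle (R : realType) (f : circle R -> R[i]) :
  ccontinuous (fun t => f (expi t)) ->
  norm2 f = (Num.sqrt (Re (cmean (fun t => `|f (expi t)| ^+ 2))))%:E.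
Proof.
move=> [cf1 cf2].
have normE t : normc (f (expi t)) ^+ 2 =
    Re (f (expi t)) ^+ 2 + Im (f (expi t)) ^+ 2.
  by case: (f _) => a b /=; rewrite sqr_sqrtr ?addr_ge0 ?sqr_ge0.
have cn : continuous (fun t => normc (f (expi t)) ^+ 2).
  move=> t; under [X in continuous_at _ X]eq_fun do rewrite normE.
  by apply: cvgD; apply: cvgM; solve [exact: cf1|exact: cf2].
have -> : cmean (fun t => `|f (expi t)| ^+ 2) =
    rmean (fun t => normc (f (expi t)) ^+ 2) +i*
    rmean (fun t => Im (`|f (expi t)| ^+ 2)).
  congr (_ +i* _); congr rmean; apply/funext => t.
  by rewrite -add_Re2_Im2 normE.
have fin_int : (\int[lebesgue_measure]_(t in `[0%R, (2 * pi)%R])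
    (normc (f (expi t)) ^+ 2)%:E)%E \is a fin_num.
  by apply: integrable_fin_num => //; exact: continuous_integrable_period cn.
by rewrite /norm2 -(fineK fin_int) -EFinM.
Qed.

End Means.

(** * Fourier coefficients and Bessel's inequality *)

Section Fourier.
Local Open Scope complex_scope.

Lemma mul_expiJ (R : realType) (t : R) : val (expi t) * (val (expi t))^* = 1.
Proof. by rewrite -sqr_normc normc_def /= cos2Dsin2 sqrtr1 expr1n. Qed.

Lemma expiX (R : realType) (d : nat) (t : R) :
  val (expi t) ^+ d = cos (d%:R * t) +i* sin (d%:R * t).
Proof.
elim: d => [|d IHd]; first by rewrite mul0r cos0 sin0.
rewrite exprS IHd -addn1 natrD mulrDl mul1r addrC cosD sinD /=; simpc.
by congr (_ +i* _); rewrite addrC.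
Qed.

Lemma expiX_mulJ (R : realType) (m k : nat) (t : R) : (k <= m)%N ->
  val (expi t) ^+ m * (val (expi t) ^+ k)^* = val (expi t) ^+ (m - k).
Proof.
move=> km; rewrite -{1}(subnK km) exprD -mulrA rmorphXn /= -exprMn mul_expiJ.
by rewrite expr1n mulr1.
Qed.

(** Only nonnegative indices occur: the Toeplitz matrices below involve the
    indices N + j - i with i < N. *)
Definition fourier (R : realType) (m : nat) (f : R -> R[i]) : R[i] :=
  cmean (fun t => f t * (val (expi t) ^+ m)^*).

Lemma ccontinuous_expiXJ (R : realType) (m : nat) :
  ccontinuous (fun t : R => (val (expi t) ^+ m)^*).
Proof. exact/ccontinuousJ/ccontinuousX/ccontinuous_expi. Qed.

Lemma cmean_expiX (R : realType) (d : nat) : (0 < d)%N ->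
  cmean (fun t : R => val (expi t) ^+ d) = 0.
Proof.
move=> d0; under eq_fun do rewrite expiX.
by rewrite /cmean rmean_cos// rmean_sin.
Qed.

Lemma fourier_expiX (R : realType) (m k : nat) :
  fourier m (fun t : R => val (expi t) ^+ k) = (k == m)%:R.
Proof.
rewrite /fourier; case: (ltngtP k m) => [km|mk|->].
- under eq_fun do
    rewrite -[X in X * _]conjcK -rmorphM /= mulrC expiX_mulJ ?(ltnW km)//.
  rewrite cmeanJ; last exact/ccontinuousX/ccontinuous_expi.
  by rewrite cmean_expiX ?subn_gt0// conjc0.
- under eq_fun do rewrite expiX_mulJ ?(ltnW mk)//.
  by rewrite cmean_expiX ?subn_gt0.
- under eq_fun do rewrite expiX_mulJ// subnn expr0.
  by rewrite /cmean /= rmean1 rmean0.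
Qed.

Lemma fourier_horner (R : realType) (s : {poly R[i]}) (m : nat) :
  fourier m (fun t => s.[val (expi t)]) = s`_m.
Proof.
rewrite /fourier; under eq_fun do rewrite horner_coef mulr_suml.
rewrite cmean_sum => [|i]; last first.
  apply: ccontinuousM; last exact: ccontinuous_expiXJ.
  apply: ccontinuousM; first exact: ccontinuous_cst.
  exact/ccontinuousX/ccontinuous_expi.
transitivity (\sum_(i < size s) s`_i * (val i == m)%:R).
  apply: eq_bigr => i _; under eq_fun do rewrite -mulrA.
  rewrite cmeanZ -?[cmean _]/(fourier _ _) ?fourier_expiX//.
  apply: ccontinuousM; last exact: ccontinuous_expiXJ.
  exact/ccontinuousX/ccontinuous_expi.
case: (ltnP m (size s)) => ms; last first.
  rewrite nth_default// big1// => i _.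
  by rewrite (ltn_eqF (leq_trans (ltn_ord i) ms)) mulr0.
rewrite (bigD1 (Ordinal ms))//= eqxx mulr1 big1 ?addr0// => i.
by rewrite -val_eqE /= => /negPf ->; rewrite mulr0.
Qed.

(** Bessel's inequality: the remainder [D] of [f] after subtracting its
    projection on the given exponentials is orthogonal to them, so
    0 <= <D, D> = <D, f> = |f|^2 - (sum of the |a_j|^2). *)
Lemma bessel (R : realType) (L : nat) (mu : 'I_L -> nat) (f : R -> R[i]) :
  injective mu -> ccontinuous f ->
  \sum_j `|fourier (mu j) f| ^+ 2 <= cmean (fun t => `|f t| ^+ 2).
Proof.
move=> injmu cf; pose a j := fourier (mu j) f.
pose e j (t : R) := val (expi t) ^+ mu j.
have ce j : ccontinuous (e j) by exact/ccontinuousX/ccontinuous_expi.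
have ceJ j : ccontinuous (fun t => (e j t)^*) by exact: ccontinuousJ.
pose D t := f t + \sum_j - a j * e j t.
have cD : ccontinuous D.
  apply: ccontinuousD => //; apply: ccontinuous_sum => j.
  exact: ccontinuousZ.
have cDM g : ccontinuous g -> cmean (fun t => D t * g t) =
    cmean (fun t => f t * g t) - \sum_j a j * cmean (fun t => e j t * g t).
  move=> cg; rewrite -sumrN.
  transitivity (cmean (fun t => f t * g t + \sum_j - a j * (e j t * g t))).
    congr cmean; apply/funext => t; rewrite mulrDl mulr_suml.
    by congr (_ + _); apply: eq_bigr => j _; rewrite mulrA.
  have ceg j : ccontinuous (fun t => e j t * g t) by exact: ccontinuousM.
  rewrite cmeanD; first last.
  - by apply: ccontinuous_sum => j; exact: ccontinuousZ.
  - exact: ccontinuousM.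
  congr (_ + _); rewrite cmean_sum => [|j]; last exact: ccontinuousZ.
  by apply: eq_bigr => j _; rewrite cmeanZ// mulNr.
have De k : cmean (fun t => D t * (e k t)^*) = 0.
  rewrite (cDM _ (ceJ k)) (bigD1 k)//= big1 => [|j jk].
    by rewrite -[X in _ * X]/(fourier _ _) fourier_expiX eqxx mulr1 addr0 subrr.
  rewrite -[X in _ * X]/(fourier _ _) fourier_expiX (inj_eq injmu).
  by rewrite (negPf jk) mulr0.
have D2 : cmean (fun t => `|D t| ^+ 2) = cmean (fun t => D t * (f t)^*).
  transitivity (cmean (fun t => D t * (f t)^* +
      \sum_j - (a j)^* * (D t * (e j t)^*))).
    congr cmean; apply/funext => t; rewrite sqr_normc {2}/D rmorphD mulrDr.
    congr (_ + _); rewrite rmorph_sum mulr_sumr; apply: eq_bigr => j _.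
    by rewrite rmorphM rmorphN mulrCA.
  have cDe j : ccontinuous (fun t => D t * (e j t)^*).
    exact: ccontinuousM cD (ceJ j).
  rewrite cmeanD; first last.
  - by apply: ccontinuous_sum => j; exact: ccontinuousZ.
  - exact: ccontinuousM cD (ccontinuousJ cf).
  rewrite cmean_sum => [|j]; last exact: ccontinuousZ.
  by rewrite big1 ?addr0// => j _; rewrite cmeanZ// De mulr0.
have := @cmean_ge0 _ (fun t => `|D t| ^+ 2)
  (fun t => exprn_ge0 2 (normr_ge0 _)).
rewrite D2 (cDM _ (ccontinuousJ cf)) subr_ge0 => le_f.
have -> : cmean (fun t => `|f t| ^+ 2) = cmean (fun t => f t * (f t)^*).
  by congr cmean; apply/funext => t; exact: sqr_normc.
apply: le_trans le_f; rewrite le_eqVlt; apply/orP; left; apply/eqP.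
apply: eq_bigr => j _; rewrite sqr_normc; congr (_ * _).
rewrite -cmeanJ; last exact: ccontinuousM cf (ceJ j).
by congr cmean; apply/funext => t; rewrite rmorphM /= conjcK mulrC.
Qed.

End Fourier.

(** * The Toeplitz matrix of the error *)

Section Toeplitz.
Local Open Scope complex_scope.

Definition toeplitz (R : realType) (N : nat) (f : R -> R[i]) : 'M[R[i]]_N :=
  \matrix_(i < N, j < N) fourier (N + j - i) f.

(** The coefficient of [f] at N + j - i is the coefficient of z^i f at N + j, so
    combining the rows of [toeplitz N f] multiplies [f] by a polynomial. *)
Lemma mul_rV_toeplitz (R : realType) (N : nat) (f : R -> R[i])
    (u : 'rV[R[i]]_N) (j : 'I_N) : ccontinuous f ->
  (u *m toeplitz N f) 0 j =
  fourier (N + j) (fun t => f t * (rVpoly u).[val (expi t)]).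
Proof.
move=> cf.
have cfe m : ccontinuous (fun t => f t * (val (expi t) ^+ m)^*).
  exact: ccontinuousM cf (ccontinuous_expiXJ R m).
rewrite mxE; transitivity (cmean (fun t => \sum_i
    u 0 i * (f t * (val (expi t) ^+ (N + j - i))^*))).
  rewrite cmean_sum => [|i]; last exact: ccontinuousZ.
  by apply: eq_bigr => i _; rewrite mxE cmeanZ.
congr cmean; apply/funext => t.
rewrite horner_poly mulr_sumr mulr_suml.
apply: eq_bigr => i _; rewrite valK.
rewrite -!mulrA mulrCA; congr (_ * (_ * _)).
have iN : (i <= N + j)%N by rewrite ltnW// ltn_addr.
rewrite -{2}(subnK iN) exprD rmorphM /= [RHS]mulrC -mulrA.
by rewrite [X in _ * X]mulrC expiX_mulJ// subnn mulr1.
Qed.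

Lemma toeplitz_frobenius_le (R : realType) (N : nat) (f : R -> R[i]) :
  ccontinuous f ->
  \sum_i \sum_j `|toeplitz N f i j| ^+ 2 <=
  N%:R * cmean (fun t => `|f t| ^+ 2).
Proof.
move=> cf; rewrite mulr_natl -[X in _ *+ X]card_ord -sumr_const.
apply: ler_sum => i _; under eq_bigr do rewrite mxE.
apply: (@bessel _ _ (fun j : 'I_N => (N + j - i)%N)) => // j k /eqP.
have iN m : (i <= N + m)%N by rewrite ltnW// ltn_addr.
by rewrite -(eqn_add2r i) !subnK// eqn_add2l => /eqP/val_inj.
Qed.

Lemma size_mul_bounded (R : nzRingType) (n N : nat) (v q : {poly R}) :
  (n < N)%N -> (size v <= N - n)%N -> (size q <= n.+1)%N ->
  (size (v * q)%R <= N)%N.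
Proof. by move=> nN sv sq; apply: leq_trans (size_polyMleq _ _) _; lia. Qed.

Lemma ccontinuous_ratfun (R : realType) (N : nat) (p q : {poly R[i]}) :
  (forall t : R, q.[val (expi t)] != 0) ->
  ccontinuous (fun t : R =>
    val (expi t) ^+ N - p.[val (expi t)] / q.[val (expi t)]).
Proof.
move=> q0; apply: ccontinuousD; first exact/ccontinuousX/ccontinuous_expi.
under [X in ccontinuous X]eq_fun do rewrite -mulNr -hornerN.
apply: ccontinuousM; first exact: ccontinuous_horner.
by apply: ccontinuousV => //; exact: ccontinuous_horner.
Qed.

(** Multiplying z^N - p/q by v q clears the denominator and leaves
    z^N (v q) - v p, whose second term has degree below N and hence does not
    reach the frequencies N + j. *)
Lemma toeplitz_ratfun_fix (R : realType) (n N : nat) (p q v : {poly R[i]}) :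
  (n < N)%N -> (size p <= n.+1)%N -> (size q <= n.+1)%N ->
  (size v <= N - n)%N -> (forall t : R, q.[val (expi t)] != 0) ->
  poly_rV (v * q) *m toeplitz N (fun t =>
    val (expi t) ^+ N - p.[val (expi t)] / q.[val (expi t)])
  = poly_rV (v * q).
Proof.
move=> nN sp sq sv q0; have svq := size_mul_bounded nN sv sq.
apply/rowP => j; rewrite mul_rV_toeplitz; last exact: ccontinuous_ratfun.
rewrite poly_rV_K//.
transitivity (fourier (N + j)
    (fun t => ('X^N * (v * q) - v * p).[val (expi t)])).
  congr fourier; apply/funext => t.
  move: (val (expi t)) (q0 t) => z qz.
  by rewrite !(hornerM, hornerD, hornerN, hornerXn); field.
rewrite fourier_horner coefB coefXnM ltnNge leq_addr /= addKn mxE.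
rewrite [(v * p)`__]nth_default ?subr0//.
by apply: leq_trans (size_mul_bounded nN sv sp) _; rewrite leq_addr.
Qed.

(** The fixed vectors are the multiples v q, and v |-> v q is injective. *)
Lemma toeplitz_ratfun_frobenius_ge (R : realType) (n N : nat)
    (p q : {poly R[i]}) :
  (n < N)%N -> (size p <= n.+1)%N -> (size q <= n.+1)%N ->
  (forall t : R, q.[val (expi t)] != 0) ->
  (N - n)%:R <= \sum_i \sum_j `|toeplitz N (fun t => val (expi t) ^+ N -
    p.[val (expi t)] / q.[val (expi t)]) i j| ^+ 2.
Proof.
move=> nN sp sq q0.
pose Q : 'M[R[i]]_(N - n, N) := lin1_mx (poly_rV \o q \o* rVpoly).
have sv (v : 'rV[R[i]]_(N - n)) : (size (rVpoly v) <= N - n)%N.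
  exact: size_poly.
apply: (@row_free_fix_le_frobenius _ _ _ Q).
  apply: inj_row_free => v; rewrite mul_rV_lin1 /= => /(congr1 rVpoly).
  rewrite poly_rV_K; last exact: size_mul_bounded sq.
  rewrite linear0 => /eqP; rewrite mulf_eq0 => /orP[/eqP v0|/eqP q00].
    by rewrite -[v]rVpolyK v0 linear0.
  by move: (q0 0); rewrite q00 horner0 eqxx.
apply/row_matrixP => i; rewrite row_mul rowE mul_rV_lin1 /=.
exact: toeplitz_ratfun_fix sq (sv _) q0.
Qed.

End Toeplitz.

Theorem theorem2 (R : realType) (n N : nat) (hnN : (n < N)%N) :
  ((Num.sqrt (1 - n%:R / N%:R))%:E
     <= dist2 (fun z : circle R => (val z ^+ N)%R) (@ratfuns R n))%E.
Proof.
apply: le_ereal_inf_tmp => _ [_ [p [q [sp sq q0 ->]] <-]].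
have qt (t : R) : q.[val (expi t)] != 0 by exact: q0.
have cF := ccontinuous_ratfun N p qt.
rewrite norm2_circle// lee_fin; apply: ler_wsqrtr.
have := le_trans (toeplitz_ratfun_frobenius_ge hnN sp sq qt)
  (toeplitz_frobenius_le N cF).
set m := cmean _.
have N0 : 0 < N%:R :> R by rewrite ltr0n (leq_trans _ hnN).
(* Both naturals are viewed as real complex numbers, to compare real parts. *)
rewrite -[N%:R](rmorph_nat (real_complex R)).
rewrite -[(N - n)%:R](rmorph_nat (real_complex R)).
case: m => a b; rewrite lecE /= !mul0r subr0 => /andP[_].
rewrite natrB ?(ltnW hnN)// mulrC -ler_pdivrMr// mulrBl divff//.
by rewrite gt_eqF.
Qed.
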